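(* Let $(X,\|\cdot\|_X)$ be a reflexive normed space whose dual $X^*$ is separable, let $(Y,\|\cdot\|_Y)$ be a normed space, let $\Phi=(\phi_k)_{k\geq 1}$ be a dense subset of $B_{X^*}(1)$, and let $|u|_\Phi := \sum_{k=1}^\infty 2^{-k}|\langle \phi_k,u\rangle|$ for $u\in X$. Let $B_X(1)=\{u\in X:\|u\|_X\leq 1\}$, and let $T:(X,\|\cdot\|_X)\to Y$ be an injective completely continuous linear operator. Then the metric spaces $(B_X(1),\|T\cdot\|_Y)$ and $(B_X(1),|\cdot|_\Phi)$ are homeomorphic to the (relative) weak topological space $(B_X(1),\sigma(X,X^* ))$, i.e., these three topological spaces are homeomorphic to each other.
   Context: $\langle\cdot,\cdot\rangle$ denotes the duality pairing between $X^*$ and $X$; $B_{X^*}(1)$ is the closed unit ball of $X^*$ for the dual norm, and density of $\Phi$ is with respect to the dual norm. $(B_X(1),\|T\cdot\|_Y)$ is the set $B_X(1)$ with the metric $d(u,v)=\|Tu-Tv\|_Y$; $(B_X(1),|\cdot|_\Phi)$ is $B_X(1)$ with the metric $d(u,v)=|u-v|_\Phi$; $(B_X(1),\sigma(X,X^* ))$ is $B_X(1)$ with the relative weak topology of $(X,\|\cdot\|_X)$. A linear operator between normed spaces is completely continuous if it maps every weakly convergent sequence to a strongly convergent sequence. *)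

(* Defs.v *)
From HB Require Import structures.
From mathcomp Require Import all_boot all_order all_algebra.
From mathcomp Require Import all_classical all_reals all_analysis.

Set Implicit Arguments.
Unset Strict Implicit.
Unset Printing Implicit Defensive.

Import Order.TTheory GRing.Theory Num.Theory.
Import numFieldNormedType.Exports.

Local Open Scope classical_set_scope.
Local Open Scope ring_scope.

Section dual_space.
Context {R : realType} (X : normedModType R).

Definition dual_pred : {pred X -> R^o} :=
  mem [set f : X -> R^o | linear f /\ continuous f].

Record dual := Dual { dual_fun :> X -> R^o ; _ : dual_fun \in dual_pred }.

HB.instance Definition _ := [isSub for dual_fun].
HB.instance Definition _ := [Choice of dual by <:].

Lemma dual_pred_submod_closed : submod_closed dual_pred.
Proof.
split; first (rewrite inE /=; split).
- by move=> a x y; rewrite /= scaler0 addr0.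
- exact: cst_continuous.
move=> a f g; rewrite !inE /= => -[lf cf] [lg cg]; split.
  move=> b x y; rewrite !fctE lf lg !scalerDr !scalerA [b * a]mulrC.
  by rewrite -!addrA; congr (_ + _); rewrite addrCA.
move=> x; apply: (@continuousD _ _ _ (a \*: f) g); last exact: cg.
by apply: cvgZl_tmp; exact: cf.
Qed.

HB.instance Definition _ :=
  GRing.isSubmodClosed.Build _ _ dual_pred dual_pred_submod_closed.
HB.instance Definition _ := [SubChoice_isSubLmodule of dual by <:].

Lemma dual_linear (f : dual) : linear f.
Proof. by case: f => f /=; rewrite inE => -[]. Qed.

Lemma dual_continuous (f : dual) : continuous f.
Proof. by case: f => f /=; rewrite inE => -[]. Qed.

HB.instance Definition _ (f : dual) :=
  GRing.isLinear.Build R X R^o *:%R f (dual_linear f).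

Definition dual_norm (f : dual) : R :=
  sup [set `|f x| | x in [set x : X | `|x| <= 1]].

Lemma dual_norm_has_sup (f : dual) :
  has_sup [set `|f x| | x in [set x : X | `|x| <= 1]].
Proof.
split; first by exists `|f 0|, 0 => //=; rewrite normr0.
have := @continuous_linear_bounded _ _ _ 0 f (@dual_continuous f 0).
by move/bounded_funP => /(_ 1)[M fM]; exists M => _ [x /= x1 <-]; exact: fM.
Qed.

Lemma dual_norm_ge (f : dual) (x : X) : `|x| <= 1 -> `|f x| <= dual_norm f.
Proof.
move=> x1; apply: ub_le_sup; last by exists x.
by case: (dual_norm_has_sup f).
Qed.

Lemma dual_norm_le (f : dual) (M : R) :
  (forall x : X, `|x| <= 1 -> `|f x| <= M) -> dual_norm f <= M.
Proof.
move=> fM; apply: ge_sup; first by case: (dual_norm_has_sup f).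
by move=> _ [x /= x1 <-]; exact: fM.
Qed.

Lemma dual_norm_ge0 (f : dual) : 0 <= dual_norm f.
Proof. by apply: (le_trans (normr_ge0 (f 0))); apply: dual_norm_ge; rewrite normr0. Qed.

Lemma dual_normP (f : dual) (x : X) : `|f x| <= dual_norm f * `|x|.
Proof.
have [->|x0] := eqVneq x 0; first by rewrite linear0 !normr0 mulr0.
rewrite -ler_pdivrMr ?normr_gt0// mulrC.
have -> : `|x|^-1 * `|f x| = `|f (`|x|^-1 *: x)|.
  by rewrite linearZ /= normrZ ger0_norm// invr_ge0.
by apply: dual_norm_ge; rewrite normrZ normfV normr_id mulVf ?normr_eq0.
Qed.

Lemma dual_normD (f g : dual) : dual_norm (f + g) <= dual_norm f + dual_norm g.
Proof.
apply: dual_norm_le => x x1.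
rewrite (le_trans (ler_normD (f x) (g x)))// lerD//; exact: dual_norm_ge.
Qed.

Lemma dual_normZ (l : R) (f : dual) : dual_norm (l *: f) = `|l| * dual_norm f.
Proof.
have le_normZ (k : R) (g : dual) : dual_norm (k *: g) <= `|k| * dual_norm g.
  apply: dual_norm_le => x x1; rewrite (normrZ k (g x)).
  by rewrite ler_wpM2l// dual_norm_ge.
apply/eqP; rewrite eq_le le_normZ /=.
have [->|l0] := eqVneq l 0; first by rewrite normr0 mul0r dual_norm_ge0.
rewrite -ler_pdivlMl ?normr_gt0//.
have := le_normZ l^-1 (l *: f).
by rewrite scalerA mulVf// scale1r normfV.
Qed.

Lemma dual_norm_eq0 (f : dual) : dual_norm f = 0 -> f = 0.
Proof.
move=> f0; apply/val_inj/funext => x /=.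
apply/eqP; rewrite -normr_le0.
by have := dual_normP f x; rewrite f0 mul0r.
Qed.

HB.instance Definition _ :=
  Lmodule_isNormed.Build R dual dual_normD dual_normZ dual_norm_eq0.

End dual_space.

Section reflexive.
Context {R : realType} (X : normedModType R).

Definition evaluation (x : X) : dual X -> R^o := fun f => f x.

Lemma evaluation_in_dual (x : X) : evaluation x \in @dual_pred R (dual X).
Proof.
rewrite inE /=; have lx : linear (evaluation x) by move=> a f g.
split => //.
pose ev : {linear dual X -> R^o} :=
  HB.pack (evaluation x) (GRing.isLinear.Build _ _ _ _ _ lx).
apply: (@bounded_linear_continuous _ _ _ ev); apply/bounded_funP => r.
exists (r * `|x|) => f fr; apply: le_trans (dual_normP f x) _.
exact: ler_wpM2r.
Qed.

Definition to_bidual (x : X) : dual (dual X) := Dual (evaluation_in_dual x).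

Definition reflexive_space := forall F : dual (dual X), exists x, to_bidual x = F.

End reflexive.

Definition separable (T : topologicalType) :=
  exists D : set T, countable D /\ dense D.

Definition weak {R : realType} (X : normedModType R) : Type := X.

HB.instance Definition _ (R : realType) (X : normedModType R) :=
  Topological.copy (weak X)
    (sup_topology (fun f : dual X => Topological.on (initial_topology f))).

Definition unit_ball {R : realType} (X : normedModType R) : set X :=
  [set x | `|x| <= 1].
Arguments unit_ball {R} X _ /.

Definition completely_continuous {R : realType} {X Y : normedModType R}
    (T : X -> Y) :=
  forall (u : nat -> X) (l : X), u @ \oo --> (l : weak X) ->
    exists y : Y, T \o u @ \oo --> y.

(* [phi k] is the element of index k + 1 of the sequence. *)
Definition seq_norm {R : realType} {X : normedModType R}
    (phi : nat -> dual X) (u : X) : R :=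
  limn (series (fun k => 2 ^- k.+1 * `|phi k u|)).

Record is_metric {R : realType} {M : Type} (d : M -> M -> R) : Prop := IsMetric {
  is_metric_xx : forall x, d x x = 0 ;
  is_metric_eq : forall x y, d x y = 0 -> x = y ;
  is_metric_sym : forall x y, d x y = d y x ;
  is_metric_triangle : forall y x z, d x z <= d x y + d y z
}.

Definition metric_space {R : realType} {M : choiceType} (d : M -> M -> R)
  (dP : is_metric d) : Type := M.

HB.instance Definition _ (R : realType) (M : choiceType) (d : M -> M -> R)
    (dP : is_metric d) := Choice.copy (metric_space dP) M.
HB.instance Definition _ (R : realType) (M : choiceType) (d : M -> M -> R)
    (dP : is_metric d) :=
  @isMetric.Build R (metric_space dP) d (is_metric_xx dP) (is_metric_eq dP)
    (is_metric_sym dP) (is_metric_triangle dP).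

Definition homeomorphic (S T : topologicalType) :=
  exists (f : S -> T) (g : T -> S),
    [/\ cancel f g, cancel g f, continuous f & continuous g].

(* Main.v *)
Require Import Defs.
From HB Require Import structures.
From mathcomp Require Import all_boot all_order all_algebra.
From mathcomp Require Import all_classical all_reals all_analysis.
From mathcomp Require Import lra.
Import Order.TTheory GRing.Theory Num.Theory.
Import numFieldNormedType.Exports.

Set Implicit Arguments.
Unset Strict Implicit.
Unset Printing Implicit Defensive.

Local Open Scope classical_set_scope.
Local Open Scope ring_scope.

(** All three topologies live on the unit ball [B], so the homeomorphisms are
identity maps, and it suffices to show that a filter on [B] has the same limits
for each of them.

Weak convergence against [|.|_Phi].  On a bounded set the tail of the series
defining [|.|_Phi] is uniformly small, so weak convergence, which controls
finitely many terms, gives convergence for [|.|_Phi]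
([seq_norm_cvg0_of_weak]).  Conversely [|.|_Phi] controls each [phi k], and by
density a functional is a multiple of some [phi k] up to an error that is
uniformly small on a bounded set ([weak_cvg_of_seq_norm]).

Weak convergence against [|T .|].  Since [|.|_Phi] metrizes the weak topology on
bounded sets, sequences are enough there to test continuity of [T], and complete
continuity says that [T] is weak-to-norm continuous on bounded sets
([completely_continuous_bounded_cvg]).  The converse is the argument that a
continuous injection of a compact space into a Hausdorff space is an embedding:
by reflexivity every bounded ultrafilter has a weak limit
([reflexive_ultra_cvg]); if [T] converges to [T x] along it, then this limit has
the same image as [x], hence is [x] ([weak_cvg_of_completely_continuous]).
The weak limit is sought in [X] rather than in [B], so that nothing has to be
known about the norm of the limit.

The same continuity property shows that [|.|_Phi] separates points: if all
functionals agree on [u] and [v], then the constant sequence [u] converges weakly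
to [v], so that [T u = T v] and [u = v]. *)

(** * Convergence in initial, weak and metric topologies *)

Lemma cvg_initial (S : choiceType) (T : topologicalType) (f : S -> T)
    (F : set_system S) (s : S) : Filter F ->
  F --> (s : initial_topology f) <-> f x @[x --> F] --> f s.
Proof.
move=> FF; split=> [Fs|fFs].
  exact: (cvg_trans (cvg_app f Fs) (@initial_continuous _ _ f s)).
move=> A /= [_ [[B Bop <-] Bfs sBfA]].
by apply: filterS sBfA _; apply: fFs; exact: open_nbhs_nbhs.
Qed.

Lemma cvg_weak (R : realType) (X : normedModType R) (F : set_system X) (x : X) :
  Filter F ->
  F --> (x : weak X) <-> forall f : dual X, f v @[v --> F] --> f x.
Proof.
move=> FF; split=> [Fx f|Fx].
  by apply/cvg_initial; exact: (proj1 (cvg_sup _ _ _) Fx f).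
by apply/cvg_sup => f; apply/cvg_initial; exact: Fx.
Qed.

Lemma cvg_metric_space (R : realType) (M : choiceType) (d : M -> M -> R)
    (dP : is_metric d) (F : set_system M) (x : M) : Filter F ->
  F --> (x : metric_space dP) <-> forall e, 0 < e -> \forall y \near F, d x y < e.
Proof.
move=> FF.
exact: (@cvg_ballP R (metric_space dP) M F FF id x).
Qed.

(** For maps that are mutually inverse, preservation and reflection of limits by
one of them give the continuity of both. *)
Lemma homeomorphic_of_cvg (S T : topologicalType) (f : S -> T) (g : T -> S) :
  cancel f g -> cancel g f ->
  (forall (F : set_system S) (x : S), ProperFilter F ->
    F --> x <-> f v @[v --> F] --> f x) ->
  homeomorphic S T.
Proof.
move=> fK gK fE; exists f, g; split=> // [x|y].
  by apply/fE; exact: cvg_id.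
apply/fE; rewrite gK => A Ay; apply: filterS Ay => z Az.
by rewrite /= gK.
Qed.

(** * The norm [|.|_Phi] *)

Section seq_norm.
Context (R : realType) (X : normedModType R) (phi : nat -> dual X).
Hypothesis phi_ball : range phi `<=` unit_ball (dual X).
Local Notation S u := (series (fun k => 2 ^- k.+1 * `|phi k u|)).

Let ge0_term (u : X) k : (0 : R) <= 2 ^- k.+1 * `|phi k u|.
Proof. by rewrite mulr_ge0// invr_ge0 exprn_ge0. Qed.

Lemma norm_phi_le k u : `|phi k u| <= `|u|.
Proof.
apply: (le_trans (dual_normP (phi k) u)).
by rewrite ler_piMl//; apply: phi_ball; exists k.
Qed.

(** The weights [2 ^- k.+1] for [N <= k < N + m] add up to
[2 ^- N - 2 ^- (N + m)]. *)
Lemma series_seq_norm_le N m u :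
  S u (N + m)%N <= S u N + (2 ^- N - 2 ^- (N + m)) * `|u|.
Proof.
elim: m => [|m IH]; first by rewrite addn0 subrr mul0r addr0.
rewrite addnS seriesSr.
have := norm_phi_le (N + m) u.
rewrite exprS invfM; set a : R := 2 ^- (N + m).
have a0 : 0 <= a by rewrite /a invr_ge0 exprn_ge0.
move: IH; rewrite -/a => IH h.
have : a * `|phi (N + m)%N u| <= a * `|u| by rewrite ler_wpM2l.
by lra.
Qed.

Lemma series_seq_norm_tail N n u : S u n <= S u N + 2 ^- N * `|u|.
Proof.
have tail0 : (0 : R) <= 2 ^- N * `|u| by rewrite mulr_ge0// invr_ge0 exprn_ge0.
have [/subnKC <-|/ltnW nN] := leqP N n.
  apply: (le_trans (series_seq_norm_le _ _ _)); rewrite lerD2l ler_wpM2r//.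
  by rewrite lerBlDr lerDl invr_ge0 exprn_ge0.
by apply: ler_wpDr => //; apply: nondecreasing_series nN => k _ _; exact: ge0_term.
Qed.

Lemma is_cvg_seq_norm u : cvgn (S u).
Proof.
apply: nondecreasing_is_cvgn; first exact: nondecreasing_series.
exists (S u 0%N + 2 ^- 0 * `|u|) => _ [n _ <-]; exact: series_seq_norm_tail.
Qed.

(** The remainder is uniformly small on bounded sets. *)
Lemma seq_norm_le N u : seq_norm phi u <= S u N + 2 ^- N * `|u|.
Proof.
apply: limr_le; first exact: is_cvg_seq_norm.
by apply: nearW => n; exact: series_seq_norm_tail.
Qed.

Lemma seq_norm_ge k u : 2 ^- k.+1 * `|phi k u| <= seq_norm phi u.
Proof.
apply: (@le_trans _ _ (S u k.+1)); last first.
  apply: nondecreasing_cvgn_le; last exact: is_cvg_seq_norm.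
  exact: nondecreasing_series.
by rewrite seriesSr lerDr; apply: sumr_ge0 => j _; exact: ge0_term.
Qed.

Lemma norm_phi_le_seq_norm k u : `|phi k u| <= 2 ^+ k.+1 * seq_norm phi u.
Proof. by rewrite -ler_pdivrMl ?exprn_gt0// seq_norm_ge. Qed.

Lemma seq_norm_ge0 u : 0 <= seq_norm phi u.
Proof. exact: le_trans (seq_norm_ge 0 u). Qed.

Lemma seq_norm0 : seq_norm phi 0 = 0.
Proof.
apply: le_anti; rewrite seq_norm_ge0 andbT.
by apply: le_trans (seq_norm_le 0 0) _; rewrite normr0 mulr0 addr0 seriesEnat /= big_geq.
Qed.

Lemma seq_normN u : seq_norm phi (- u) = seq_norm phi u.
Proof.
by congr (limn (series _)); apply/funext => k; rewrite linearN /= normrN.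
Qed.

Lemma seq_normD u v : seq_norm phi (u + v) <= seq_norm phi u + seq_norm phi v.
Proof.
rewrite -limD; try exact: is_cvg_seq_norm.
apply: ler_lim; first exact: is_cvg_seq_norm.
  by apply: is_cvgD; exact: is_cvg_seq_norm.
apply: nearW => n; rewrite -[leRHS]/(S u n + S v n) /series /= -big_split/=.
apply: ler_sum => k _; rewrite -mulrDr ler_wpM2l ?invr_ge0 ?exprn_ge0//.
by rewrite linearD; exact: ler_normD.
Qed.

(** The remainder after [N] terms is below [e / 2] for all vectors of the bounded
set at once, and the first [N] terms tend to 0 since each involves only one
functional. *)
Lemma seq_norm_cvg0_of_weak (F : set_system X) (x : X) (r : R)
    {FF : Filter F} :
  (\forall v \near F, `|v| <= r) ->
  F --> (x : weak X) -> seq_norm phi (v - x) @[v --> F] --> 0.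
Proof.
move=> Fr /cvg_weak Fx; apply/cvgr0Pnorm_lt => e e0.
(* [M] bounds the norm of [v - x] and is positive even when [r] is not. *)
pose M : R := `|r| + `|x| + 1.
have M0 : 0 < M by rewrite /M; have := normr_ge0 r; have := normr_ge0 x; lra.
have [N _ Ne] : \forall N \near \oo, 2 ^- N < e / 2 / M.
  have h : (2^-1 : R) ^+ n @[n --> \oo] --> 0 by apply: cvg_expr; rewrite ger0_norm; lra.
  move/cvgr0Pnorm_lt : h => /(_ (e / 2 / M)); rewrite !divr_gt0// => /(_ isT).
  by apply: filterS => n; rewrite exprVn ger0_norm// invr_ge0 exprn_ge0.
have {Ne} := Ne N (leqnn N); rewrite ltr_pdivlMr// => Ne.
have cS : S (v - x) N @[v --> F] --> 0.
  elim: N {Ne} => [|k IH].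
    by under eq_fun do rewrite seriesEnat /= big_geq//; exact: cvg_cst.
  have phi0 : phi k (v - x) @[v --> F] --> (0 : R^o).
    under eq_fun do rewrite linearB /=.
    by rewrite -(subrr (phi k x)); apply: cvgB; [exact: Fx|exact: cvg_cst].
  have := cvgD IH (cvgM (cvg_cst (2 ^- k.+1 : R)) (cvg_norm phi0)).
  rewrite normr0 mulr0 addr0 => h; set g := (X in X @ F --> _).
  by have -> : g = (fun v => S (v - x) k + 2 ^- k.+1 * `|phi k (v - x)|);
    [apply/funext => v; rewrite /g seriesSr|exact: h].
move/cvgr0Pnorm_lt : cS => /(_ (e / 2)); rewrite divr_gt0// => /(_ isT) cS.
near=> v.
rewrite ger0_norm ?seq_norm_ge0//; apply: le_lt_trans (seq_norm_le N _) _.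
have h1 : S (v - x) N < e / 2.
  by apply: le_lt_trans (ler_norm _) _; near: v.
have : 2 ^- N * `|v - x| <= 2 ^- N * M.
  rewrite ler_wpM2l ?invr_ge0 ?exprn_ge0//.
  apply: le_trans (ler_normB _ _) _.
  have : `|v| <= r by near: v.
  by rewrite /M; have := ler_norm r; lra.
by lra.
Unshelve. all: by end_near. Qed.

Hypothesis phi_dense : unit_ball (dual X) `<=` closure (range phi).

(** The functional [f / c] with [c = |f| + 1] lies in the unit ball of the dual,
where some [phi k] approximates it within [e / c]. *)
Lemma dual_approx (f : dual X) (e : R) : 0 < e -> exists2 c : R, 0 < c &
  exists k, forall u, `|f u| <= c * `|phi k u| + e * `|u|.
Proof.
move=> e0; pose c := `|f| + 1.
have c0 : 0 < c by rewrite ltr_wpDl.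
exists c => //.
have : closure (range phi) (c^-1 *: f).
  apply: phi_dense; rewrite /= normrZ ger0_norm ?invr_ge0 ?(ltW c0)//.
  by rewrite ler_pdivrMl// mulr1 /c lerDl.
move=> /(_ _ (nbhsx_ballx (c^-1 *: f) (e / c) (divr_gt0 e0 c0))).
move=> [_ [[k _ <-]]]; rewrite -ball_normE /= => fk; exists k => u.
have -> : f u = c * ((c^-1 *: f - phi k) u + phi k u).
  rewrite /= -[phi k u]/(phi k u) -[LHS](mulVKf (lt0r_neq0 c0)); congr (c * _).
  by rewrite -[RHS]/(c^-1 * f u - phi k u + phi k u) subrK.
rewrite normrM (ger0_norm (ltW c0)) -(mulVKf (lt0r_neq0 c0) e) -mulrA -mulrDr.
rewrite ler_wpM2l ?(ltW c0)// addrC; apply: le_trans (ler_normD _ _) _.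
rewrite [leRHS]addrC [X in X <= _]addrC lerD2r.
apply: le_trans (dual_normP _ _) _; rewrite ler_wpM2r//.
by rewrite mulrC; exact: ltW.
Qed.

Lemma seq_norm_eq0 (u : X) : seq_norm phi u = 0 -> forall f : dual X, f u = 0.
Proof.
move=> u0 f; apply/eqP; rewrite -normr_le0; apply/ler_addgt0Pl => e e0.
have [|c c0 [k /(_ u) fk]] := @dual_approx f (e / (`|u| + 1)) _.
  by rewrite divr_gt0// ltr_wpDl.
have := norm_phi_le_seq_norm k u; rewrite u0 mulr0 normr_le0 => /eqP phiu.
rewrite addr0; apply: le_trans fk _; rewrite phiu normr0 mulr0 add0r.
by rewrite mulrAC ler_pdivrMr ?ltr_wpDl// ler_wpM2l ?(ltW e0)// lerDl.
Qed.

Lemma weak_cvg_of_seq_norm (F : set_system X) (x : X) (r : R)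
    {FF : Filter F} :
  (\forall v \near F, `|v| <= r) ->
  seq_norm phi (v - x) @[v --> F] --> 0 -> F --> (x : weak X).
Proof.
move=> Fr F0; apply/cvg_weak => f; apply/cvgrPdist_lt => e e0.
pose M : R := `|r| + `|x| + 1.
have M0 : 0 < M by rewrite /M; have := normr_ge0 r; have := normr_ge0 x; lra.
have eM : 0 < e / 2 / M by rewrite !divr_gt0.
have [c c0 [k fk]] := dual_approx f eM.
pose d := e / 2 / (c * 2 ^+ k.+1).
have c2 : 0 < c * 2 ^+ k.+1 by rewrite mulr_gt0// exprn_gt0.
have d0 : 0 < d by rewrite !divr_gt0.
move/cvgr0Pnorm_lt : F0 => /(_ _ d0) F0.
near=> v.
rewrite distrC -linearB; apply: le_lt_trans (fk _) _.
have : c * `|phi k (v - x)| < e / 2.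
  apply: (@le_lt_trans _ _ (c * 2 ^+ k.+1 * seq_norm phi (v - x))).
    by rewrite -mulrA ler_wpM2l ?(ltW c0)// norm_phi_le_seq_norm.
  rewrite -ltr_pdivlMl// mulrC; apply: le_lt_trans (ler_norm _) _; by near: v.
have : e / 2 / M * `|v - x| <= e / 2.
  rewrite -[leRHS](divfK (lt0r_neq0 M0)) ler_wpM2l ?(ltW eM)//.
  apply: le_trans (ler_normB _ _) _.
  have : `|v| <= r by near: v.
  by rewrite /M; have := ler_norm r; lra.
by lra.
Unshelve. all: by end_near. Qed.

End seq_norm.

(** * Weak limits of bounded ultrafilters *)

Lemma ultra_bounded_cvg (R : realType) (S : Type) (F : set_system S)
    (f : S -> R) (M : R) : UltraFilter F ->
  (\forall v \near F, `|f v| <= M) -> cvg (f v @[v --> F]).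
Proof.
move=> FU FM.
have [|p [_ clp]] := @segment_compact R (- M) M (f v @[v --> F]) _.
  by apply: filterS FM => v; rewrite /= in_itv/= ler_norml.
apply/cvg_ex; exists p => A Ap.
have [//|FnA] := in_ultra_setVsetC (f @^-1` A) FU.
by have [q []] := clp (~` A) A FnA Ap.
Qed.

(** Along the ultrafilter every functional [f] is bounded and so has a limit
[L f]; the functional [L] is linear and bounded on the dual, hence is evaluation
at a point. *)
Lemma reflexive_ultra_cvg (R : realType) (X : normedModType R)
    (F : set_system X) (r : R) : reflexive_space X -> UltraFilter F ->
  (\forall v \near F, `|v| <= r) -> exists x : X, F --> (x : weak X).
Proof.
move=> X_reflexive FU Fr.
have fle (f : dual X) : \forall v \near F, `|f v| <= r * `|f|.
  apply: filterS Fr => v vr; apply: le_trans (dual_normP f v) _.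
  by rewrite mulrC ler_wpM2r// dual_norm_ge0.
have fcvg (f : dual X) : cvg (f v @[v --> F]).
  by apply: ultra_bounded_cvg; exact: fle.
pose L (f : dual X) : R^o := lim (f v @[v --> F]).
have L_linear : linear L.
  move=> a f g; apply: cvg_lim => //.
  by apply: (cvgD _ (fcvg g)); apply: cvgZl_tmp; exact: fcvg.
pose Llin : {linear dual X -> R^o} :=
  HB.pack L (GRing.isLinear.Build _ _ _ _ _ L_linear).
have L_dual : L \in @dual_pred R (dual X).
  rewrite inE; split=> //.
  apply: (@bounded_linear_continuous _ _ _ Llin); apply/bounded_funP => s.
  exists (`|r| * s) => f fs; rewrite /= /L.
  rewrite -lim_norm//; apply: limr_le; first exact: is_cvg_norm.
  apply: filterS (fle f) => v; move/le_trans; apply.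
  apply: (@le_trans _ _ (`|r| * `|f|)); last exact: ler_wpM2l.
  by rewrite ler_wpM2r ?ler_norm// dual_norm_ge0.
have [x xL] := X_reflexive (Dual L_dual).
exists x; apply/cvg_weak => f.
have -> : f x = L f by rewrite -[RHS]/(dual_fun (Dual L_dual) f) -xL.
exact: fcvg.
Qed.

(** * Completely continuous maps *)

(** Complete continuity asks only for some limit of the images; that it is [T l]
follows by interleaving the sequence with the constant sequence [l], because the
new sequence still converges weakly to [l]. *)
Lemma completely_continuous_cvg (R : realType) (X Y : normedModType R)
    (T : X -> Y) (u : nat -> X) (l : X) : completely_continuous T ->
  u @ \oo --> (l : weak X) -> T \o u @ \oo --> T l.
Proof.
move=> T_cc ul; pose w n := if odd n then l else u n./2.
have [A|y wy] := T_cc w l.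
  move=> Al; have [N _ NA] := ul A Al.
  exists N.*2 => // n /= Nn; rewrite /w; case: ifP => _.
    exact: (@nbhs_singleton (weak X)).
  by apply: NA => /=; rewrite -(doubleK N) half_leq.
have weven : T \o u @ \oo --> y.
  move=> A /wy [N _ NA]; exists N => // n /= Nn.
  have := NA n.*2; rewrite /= /w odd_double doubleK; apply.
  by rewrite -addnn; exact: leq_trans Nn (leq_addr _ _).
suff -> : T l = y by [].
have wodd : (fun=> T l) @ \oo --> y.
  move=> A /wy [N _ NA]; exists N => // n /= Nn.
  have := NA n.*2.+1; rewrite /= /w /= odd_double /=; apply.
  by rewrite -addnn ltnW// ltnS; exact: leq_trans Nn (leq_addr _ _).
by apply: (cvg_unique _ (@cvg_cst _ (T l) _ \oo _) wodd).
Qed.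

(** The weak topology does not separate [u] from [v], so the constant sequence [u]
converges weakly to [v]. *)
Lemma completely_continuous_eq (R : realType) (X Y : normedModType R)
    (T : X -> Y) (u v : X) : completely_continuous T ->
  (forall f : dual X, f u = f v) -> T u = T v.
Proof.
move=> T_cc uv.
have uv_cvg : (fun=> u) @ \oo --> (v : weak X).
  by apply/cvg_weak => f; rewrite -uv; exact: cvg_cst.
have Tuv := completely_continuous_cvg T_cc uv_cvg.
exact: (cvg_unique _ (@cvg_cst _ (T u) _ \oo _) Tuv).
Qed.

Section bounded_sets.
Context (R : realType) (X Y : normedModType R) (phi : nat -> dual X).
Context (T : X -> Y).
Hypothesis phi_ball : range phi `<=` unit_ball (dual X).
Hypothesis phi_dense : unit_ball (dual X) `<=` closure (range phi).
Hypothesis T_cc : completely_continuous T.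

(** Sequences suffice because [|.|_Phi] metrizes the weak topology on bounded
sets: otherwise every ball of radius [1 / n.+1] for [|.|_Phi] contains a bounded
[u n] whose image is at distance at least [e] from [T x]. *)
Lemma completely_continuous_bounded_cvg (F : set_system X) (x : X) (r : R)
    {FF : Filter F} : (\forall v \near F, `|v| <= r) ->
  F --> (x : weak X) -> T v @[v --> F] --> T x.
Proof.
move=> Fr Fx; apply: contrapT => nTx.
have [e e0 nFe] : exists2 e, 0 < e & ~ \forall v \near F, `|T x - T v| < e.
  apply: contrapT => ne; apply: nTx; apply/cvgrPdist_lt => e e0.
  by apply: contrapT => nFe; apply: ne; exists e.
have /cvgr0Pnorm_lt F0 : seq_norm phi (v - x) @[v --> F] --> 0.
  exact: seq_norm_cvg0_of_weak Fr Fx.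
have /choice [u u_spec] : forall n : nat, exists v, [/\ `|v| <= r,
    seq_norm phi (v - x) < n.+1%:R^-1 & ~ `|T x - T v| < e].
  move=> n; apply: contrapT => nv; apply: nFe.
  move: (F0 n.+1%:R^-1); rewrite invr_gt0 ltr0n => /(_ isT).
  apply: filterS2 Fr => v vr /(le_lt_trans (ler_norm _)) vn.
  by apply: contrapT => Tv; apply: nv; exists v.
have ux : u @ \oo --> (x : weak X).
  apply: (weak_cvg_of_seq_norm phi_ball phi_dense (r := r)).
    by exists 0%N => // n _ /=; case: (u_spec n).
  have : seq_norm phi (u n - x) @[n --> \oo] --> 0; last by [].
  apply: (@squeeze_cvgr _ _ _ _ (fun=> 0) (@harmonic R)).
  - apply: nearW => n; rewrite seq_norm_ge0//=.
    by case: (u_spec n) => _ /ltW.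
  - exact: cvg_cst.
  - exact: cvg_harmonic.
have /cvgrPdist_lt /(_ _ e0) [N _ /(_ N (leqnn N)) /=] :=
  completely_continuous_cvg T_cc ux.
by case: (u_spec N).
Qed.

Hypothesis X_reflexive : reflexive_space X.
Hypothesis T_inj : injective T.

(** A filter that misses a weak neighbourhood [A] of [x] extends to an ultrafilter
containing the complement of [A]; its weak limit has the image [T x] and so is
[x], which is absurd. *)
Lemma weak_cvg_of_completely_continuous (F : set_system X) (x : X) (r : R)
    {FF : ProperFilter F} : (\forall v \near F, `|v| <= r) ->
  T v @[v --> F] --> T x -> F --> (x : weak X).
Proof.
move=> Fr TFx A Ax; apply: contrapT => nFA.
have [G [GU FG]] : exists G, UltraFilter G /\ within (~` A) F `<=` G.
  apply: ultraFilterLemma; apply: Build_ProperFilter_ex.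
  move=> B FB; apply: contrapT => nB; apply: nFA.
  apply: (@filterS _ F _ _ A _ FB) => v vB; apply: contrapT => nAv; apply: nB.
  by exists v; apply: vB.
have GP : ProperFilter G by exact: ultra_proper.
have sFG : F `<=` G by move=> B FB; apply: FG; apply: filterS FB.
have Gr := sFG _ Fr.
have [y Gy] := reflexive_ultra_cvg X_reflexive GU Gr.
have TGy : T v @[v --> G] --> T y.
  exact: completely_continuous_bounded_cvg Gr Gy.
have TGx : T v @[v --> G] --> T x.
  by move=> B TB; apply: sFG; exact: TFx.
have xy : x = y by apply: T_inj; exact: (cvg_unique _ TGx TGy).
have GA : G A by apply: Gy; rewrite -xy.
have GnA : G (~` A) by apply: FG; exact: withinT.
by have [v []] := filter_ex (filterI GA GnA).
Qed.

End bounded_sets.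

(** * The three topologies on the unit ball *)

Theorem corollary1p17 (R : realType) (X Y : normedModType R)
  (X_reflexive : reflexive_space X) (dual_separable : separable (dual X))
  (phi : nat -> dual X)
  (phi_ball : range phi `<=` unit_ball (dual X))
  (phi_dense : unit_ball (dual X) `<=` closure (range phi))
  (T : {linear X -> Y}) (T_inj : injective T)
  (T_cc : completely_continuous T) :
  let B := unit_ball X in
  let dT := fun u v : B => `|T (\val u) - T (\val v)| in
  let dphi := fun u v : B => seq_norm phi (\val u - \val v) in
  let Bweak := set_type (B : set (weak X)) in
  exists (dT_metric : is_metric dT) (dphi_metric : is_metric dphi),
    [/\ homeomorphic (metric_space dT_metric) Bweak,
        homeomorphic (metric_space dphi_metric) Bweak &
        homeomorphic (metric_space dT_metric) (metric_space dphi_metric)].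
Proof.
move=> B dT dphi Bweak.
have dT_metric : is_metric dT.
  split=> [u|u v|u v|v u w]; rewrite /dT.
  - by rewrite subrr normr0.
  - by move=> /normr0_eq0/eqP; rewrite subr_eq0 => /eqP/T_inj/val_inj.
  - by rewrite distrC.
  - exact: ler_distD.
have dphi_metric : is_metric dphi.
  split=> [u|u v uv0|u v|v u w]; rewrite /dphi.
  - by rewrite subrr seq_norm0.
  - apply/val_inj/T_inj/completely_continuous_eq => // f.
    apply/eqP; rewrite -subr_eq0 -linearB; apply/eqP.
    exact: seq_norm_eq0 uv0 f.
  - by rewrite -seq_normN opprB.
  - have -> : \val u - \val w = (\val u - \val v) + (\val v - \val w).
      by rewrite addrA subrK.
    exact: seq_normD.
exists dT_metric, dphi_metric.
have ballF (F : set_system B) : Filter F ->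
    \forall v \near (\val u @[u --> F]), `|v| <= 1.
  by move=> FF; apply: (@filterE _ F) => u; exact: (set_valP u).
have weakE (F : set_system B) (u : B) : ProperFilter F ->
    F --> (u : Bweak) <-> \val v @[v --> F] --> (\val u : weak X).
  by move=> FF; exact: cvg_initial.
have dTE (F : set_system B) (u : B) : ProperFilter F ->
    F --> (u : Bweak) <-> F --> (u : metric_space dT_metric).
  move=> FF; split.
    move=> /weakE Fu; apply/cvg_metric_space => e e0.
    have /cvgrPdist_lt/(_ _ e0) : T (\val v) @[v --> F] --> T (\val u).
      exact (completely_continuous_bounded_cvg phi_ball phi_dense T_cc
        (ballF _ _) Fu).
    by [].
  move=> /cvg_metric_space Fu; apply/weakE.
  have TFu : T (\val v) @[v --> F] --> T (\val u).
    by apply/cvgrPdist_lt => e e0; exact: Fu.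
  exact: (weak_cvg_of_completely_continuous phi_ball phi_dense T_cc X_reflexive
    T_inj (ballF _ _) TFu).
have dphiE (F : set_system B) (u : B) : ProperFilter F ->
    F --> (u : Bweak) <-> F --> (u : metric_space dphi_metric).
  move=> FF; split.
    move=> /weakE Fu; apply/cvg_metric_space => e e0.
    have /cvgr0Pnorm_lt/(_ _ e0) :
        seq_norm phi (\val v - \val u) @[v --> F] --> 0.
      exact (seq_norm_cvg0_of_weak phi_ball (ballF _ _) Fu).
    move=> Fe; apply: (filterS _ Fe) => v.
    by rewrite ger0_norm ?seq_norm_ge0// -seq_normN opprB.
  move=> /cvg_metric_space Fu; apply/weakE.
  have F0 : seq_norm phi (\val v - \val u) @[v --> F] --> 0.
    apply/cvgr0Pnorm_lt => e /Fu Fe; apply: (filterS _ Fe) => v.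
    by rewrite ger0_norm ?seq_norm_ge0// -[in X in _ -> X]seq_normN opprB.
  exact (weak_cvg_of_seq_norm phi_ball phi_dense (ballF _ _) F0).
pose BT := metric_space dT_metric; pose Bphi := metric_space dphi_metric.
split.
- apply: (@homeomorphic_of_cvg BT Bweak id id) => // F u FF.
  by apply: iff_sym; exact: dTE.
- apply: (@homeomorphic_of_cvg Bphi Bweak id id) => // F u FF.
  by apply: iff_sym; exact: dphiE.
- apply: (@homeomorphic_of_cvg BT Bphi id id) => // F u FF.
  exact: iff_trans (iff_sym (dTE F u FF)) (dphiE F u FF).
Qed.
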